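(* Let $0<q\le2$, $\gamma>0$ and $\mathbf{B}^\delta\in\mathbb{C}^{m\times N}$. With $\mathbf{M}$ the FDEM forward operator, $\mathbf{D}$ the discrete Laplacian and $\iota_0$ the indicator function of the non-negative cone (all defined in the context), let $$\mathcal{J}(\mathbf{\Sigma})=\frac12\|\mathbf{M}(\mathbf{\Sigma})-\mathbf{B}^\delta\|_F^2+\frac{\gamma}{q}\|\mathbf{D}(\mathbf{\Sigma})\|_q^q+\iota_0(\mathbf{\Sigma}),\qquad\mathbf{\Sigma}\in\mathbb{R}^{n\times N}.$$ Then $\mathcal{J}$ admits a global minimizer.
   Context: Norms. $\|\cdot\|_F$ is the Frobenius norm. For $q>0$ and a real vector $\mathbf{x}$, $\|\mathbf{x}\|_q^q=\sum_i|x_i|^q$ (for $0<q<1$ this does not come from a norm). $\mathbf{\Sigma}\ge0$ means that all entries are non-negative; $\iota_0(\mathbf{\Sigma})=0$ if $\mathbf{\Sigma}\ge0$ and $\iota_0(\mathbf{\Sigma})=+\infty$ otherwise (so functionals containing $\iota_0$ take the value $+\infty$ off the non-negative cone, and only the values of $\mathbf{M}$ on the cone matter). Discrete Laplacian. For $\mathbf{\Sigma}\in\mathbb{R}^{n\times N}$, $\mathbf{D}(\mathbf{\Sigma})=D\,\mathrm{vec}(\mathbf{\Sigma})\in\mathbb{R}^{nN}$, where $\mathrm{vec}$ stacks columns and $D=L_N\otimes I_n+I_N\otimes L_n$, with $\otimes$ the Kronecker product, $I_k$ the $k\times k$ identity, and $L_k$ the $k\times k$ tridiagonal matrix with $2$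 on the diagonal and $-1$ on the sub- and superdiagonal (zero boundary conditions). Forward operator. The soil has $n$ layers. Layer $i$ has conductivity $\sigma_i$, magnetic permeability $\mu_i=\mu_0:=4\pi\cdot10^{-7}$ (known and constant), and thickness $d_i>0$, with $d_n=\infty$. For conductivities $\boldsymbol{\sigma}=(\sigma_1,\dots,\sigma_n)^T$, angular frequency $\omega>0$ and $\lambda>0$, put $u_i(\lambda)=\sqrt{\lambda^2+\mathrm{i}\sigma_i\mu_i\omega}$ with $\mathrm{Re}(u_i(\lambda))\ge0$, $N_i(\lambda)=u_i(\lambda)/(\mathrm{i}\mu_i\omega)$, $N_0(\lambda)=\lambda/(\mathrm{i}\mu_0\omega)$. The surface admittances are $Y_n(\lambda)=N_n(\lambda)$ and, for $i=n-1,\dots,1$, $$Y_i(\lambda)=N_i(\lambda)\frac{Y_{i+1}(\lambda)+N_i(\lambda)\tanh(d_iu_i(\lambda))}{N_i(\lambda)+Y_{i+1}(\lambda)\tanh(d_iu_i(\lambda))}.$$ The reflection factor is $R_{\omega,0}(\lambda)=\dfrac{N_0(\lambda)-Y_1(\lambda)}{N_0(\lambda)+Y_1(\lambda)}$. For coil orientation $\nu\in\{0,1\}$ (vertical/horizontal), instrument height $h>0$ and inter-coil distance $\rho>0$, $$M_\nu(\boldsymbol{\sigma};h,\omega,\rho)=-\rho^{3-\nu}\int_0^\infty\lambda^{1-\nu}e^{-2h\lambda}R_{\omega,0}(\lambda)J_\nu(\rho\lambda)\lambda\,d\lambda,$$ where $J_0,J_1$ are the Bessel functions of the first kind of orders $0,1$.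 Fix finitely many inter-coil distances $\rho_1,\dots,\rho_{m_\rho}$, heights $h_1,\dots,h_{m_h}$ and angular frequencies $\omega_1,\dots,\omega_{m_\omega}$, and let $m=2m_\rho m_hm_\omega$. Then $M(\boldsymbol{\sigma})\in\mathbb{C}^m$ is the vector collecting, in a fixed order, all values $M_\nu(\boldsymbol{\sigma};h_l,\omega_s,\rho_t)$ for $\nu\in\{0,1\}$, $1\le t\le m_\rho$, $1\le l\le m_h$, $1\le s\le m_\omega$. For $\mathbf{\Sigma}=[\boldsymbol{\sigma}_1,\dots,\boldsymbol{\sigma}_N]\in\mathbb{R}^{n\times N}$, $\mathbf{M}(\mathbf{\Sigma})=[M(\boldsymbol{\sigma}_1),\dots,M(\boldsymbol{\sigma}_N)]\in\mathbb{C}^{m\times N}$. *)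

(* Defs.v *)
From mathcomp Require Import all_boot all_order all_algebra.
From mathcomp Require Import all_classical all_reals all_analysis.
From mathcomp.real_closed Require Import complex mxtens.

Set Implicit Arguments.
Unset Strict Implicit.
Unset Printing Implicit Defensive.

Import Order.TTheory GRing.Theory Num.Theory.
Import numFieldNormedType.Exports.

Local Open Scope ring_scope.
Local Open Scope classical_set_scope.
Local Open Scope complex_scope.

Definition expC {R : realType} (z : R[i]) : R[i] :=
  (expR (complex.Re z))%:C * (cos (complex.Im z) +i* sin (complex.Im z)).

Definition tanhC {R : realType} (z : R[i]) : R[i] :=
  (expC z - expC (- z)) / (expC z + expC (- z)).

(* Bessel function of the first kind of integer order nu *)
Definition besselJ {R : realType} (nu : nat) (x : R) : R :=
  limn (series (fun k : nat =>
    (-1) ^+ k / (k`! * (k + nu)`!)%:R * (x / 2) ^+ (2 * k + nu))).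

Definition integralC {R : realType} (D : set R) (f : R -> R[i]) : R[i] :=
  (\int[lebesgue_measure]_(x in D) complex.Re (f x)) +i*
  (\int[lebesgue_measure]_(x in D) complex.Im (f x)).

Definition mu0 {R : realType} : R := 4 * pi * 10 ^- 7.

(* [sqrtc] is the square root with nonnegative real part. *)
Lemma Re_sqrtc_ge0 {R : realType} (z : R[i]) : 0 <= complex.Re (sqrtc z).
Proof. by case: z => a b /=; exact: sqrtr_ge0. Qed.

Definition layer_u {R : realType} (omega lambda sigma : R) : R[i] :=
  sqrtc ((lambda ^+ 2)%:C + 'i%C * (sigma * mu0 * omega)%:C).

Definition layer_N {R : realType} (omega lambda sigma : R) : R[i] :=
  layer_u omega lambda sigma / ('i%C * (mu0 * omega)%:C).

Definition air_N {R : realType} (omega lambda : R) : R[i] :=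
  lambda%:C / ('i%C * (mu0 * omega)%:C).

(* Y_1 for a stack of n.+1 layers, the last of which is a half-space without
   a thickness. Since Y_i only involves the layers from i downwards, Y_2 is the
   Y_1 of the stack deprived of its top layer. *)
Fixpoint admittance {R : realType} (omega lambda : R) (n : nat) :
    ('I_n -> R) -> ('I_n.+1 -> R) -> R[i] :=
  if n is n'.+1 then fun d sigma =>
    let u1 := layer_u omega lambda (sigma ord0) in
    let N1 := layer_N omega lambda (sigma ord0) in
    let Y2 := admittance omega lambda (fun i => d (lift ord0 i))
                                      (fun i => sigma (lift ord0 i)) in
    let t1 := tanhC ((d ord0)%:C * u1) in
    N1 * ((Y2 + N1 * t1) / (N1 + Y2 * t1))
  else fun _ sigma => layer_N omega lambda (sigma ord0).

Definition reflection {R : realType} (n : nat) (d : 'I_n -> R)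
    (sigma : 'I_n.+1 -> R) (omega lambda : R) : R[i] :=
  let N0 := air_N omega lambda in
  let Y1 := admittance omega lambda d sigma in
  (N0 - Y1) / (N0 + Y1).

(* nu = 0, 1, so the natural number subtractions in exponents are exact. *)
Definition coil_response {R : realType} (n : nat) (d : 'I_n -> R)
    (nu : 'I_2) (sigma : 'I_n.+1 -> R) (h omega rho : R) : R[i] :=
  - (rho ^+ (3 - nu))%:C *
  integralC `]0, +oo[ (fun lambda =>
    (lambda ^+ (1 - nu) * expR (- 2 * h * lambda))%:C *
    reflection d sigma omega lambda *
    (besselJ nu (rho * lambda) * lambda)%:C).

(* [ord] is the order in which the measurements are listed. *)
Definition fdem {R : realType} (n N mrho mh momega : nat) (d : 'I_n -> R)
    (rho : 'I_mrho -> R) (h : 'I_mh -> R) (omega : 'I_momega -> R)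
    (ord : 'I_(2 * mrho * mh * momega) -> 'I_2 * 'I_mrho * 'I_mh * 'I_momega)
    (Sigma : 'M[R]_(n.+1, N)) : 'M[R[i]]_(2 * mrho * mh * momega, N) :=
  \matrix_(k, j) let: (nu, t, l, s) := ord k in
    coil_response d nu (fun i => Sigma i j) (h l) (omega s) (rho t).

Definition laplacian1 (R : pzRingType) (k : nat) : 'M[R]_k :=
  \matrix_(i, j) if i == j then 2
                 else if (i.+1 == j :> nat) || (j.+1 == i :> nat) then -1
                 else 0.

(* Column stacking: entry (i, j) goes to position j * n + i, the index
   convention of [tensmx]. *)
Definition vec {R : Type} (n N : nat) (Sigma : 'M[R]_(n, N)) : 'cV[R]_(N * n) :=
  \col_k Sigma (mxtens_unindex k).2 (mxtens_unindex k).1.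

Definition laplacian (R : pzRingType) (n N : nat) : 'M[R]_(N * n) :=
  tensmx (laplacian1 R N) (1%:M : 'M[R]_n) +
  tensmx (1%:M : 'M[R]_N) (laplacian1 R n).

Definition discrete_laplacian {R : pzRingType} (n N : nat)
    (Sigma : 'M[R]_(n, N)) : 'cV[R]_(N * n) :=
  laplacian R n N *m vec Sigma.

Definition frobenius {R : realType} (m N : nat) (A : 'M[R[i]]_(m, N)) : R :=
  Num.sqrt (\sum_(i < m) \sum_(j < N) ComplexField.Normc.normc (A i j) ^+ 2).

(* The q-th power of the l^q (quasi-)norm *)
Definition lq_pow {R : realType} (k : nat) (q : R) (x : 'cV[R]_k) : R :=
  \sum_(i < k) `|x i ord0| `^ q.

Definition iota0 {R : realType} (n N : nat) (Sigma : 'M[R]_(n, N)) : \bar R :=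
  if [forall i, forall j, 0 <= Sigma i j] then 0%E else +oo%E.

Definition objective {R : realType} (n N mrho mh momega : nat) (d : 'I_n -> R)
    (rho : 'I_mrho -> R) (h : 'I_mh -> R) (omega : 'I_momega -> R)
    (ord : 'I_(2 * mrho * mh * momega) -> 'I_2 * 'I_mrho * 'I_mh * 'I_momega)
    (q gamma : R) (B : 'M[R[i]]_(2 * mrho * mh * momega, N))
    (Sigma : 'M[R]_(n.+1, N)) : \bar R :=
  ((1 / 2 * frobenius (fdem d rho h omega ord Sigma - B) ^+ 2)%:E +
   (gamma / q * lq_pow q (discrete_laplacian Sigma))%:E +
   iota0 Sigma)%E.

(* Main.v *)
Require Import Defs.
From mathcomp Require Import all_boot all_order all_algebra.
From mathcomp Require Import all_classical all_reals all_analysis.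
From mathcomp Require Import measurable_realfun exponential_distribution.
From mathcomp.real_closed Require Import complex mxtens.
From mathcomp Require Import ring lra.

(** The theorem is an instance of the direct method: on the non-negative cone the
objective is finite, continuous and coercive, hence it attains its minimum, and
off the cone it is infinite.

Coercivity. The Laplacian with zero boundary conditions has non-positive
off-diagonal entries, and it maps a positive concave parabola, constant in the
other direction, to a vector with entries at least 1. By the comparison principle
([zmatrix_comparison]), an upper bound on the entries of [D(Sigma)] yields an
upper bound on the entries of [Sigma] ([laplacian_le_parabola]); non-negativity
is the lower bound. The penalty controls the entries of [D(Sigma)] for every
positive exponent [q], so sublevel sets are contained in boxes.

Continuity. The reflection factor is continuous and bounded by 1 because the
surface admittances, multiplied by [i mu0 omega], never leave the quadrant
[Re > 0], [Im >= 0]. This is the energy estimate for [E'' = u^2 E] in a layer,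
made explicit with hyperbolic functions ([admittance_step]): both [u^2] and the
admittance from below lie in the first quadrant, and the argument of [u] is at
most [pi/4]. It follows that no denominator vanishes, so that the reflection
factor is continuous in the conductivities and in [lambda] ([cvgC_reflection]),
and that its modulus is at most 1 ([reflection_le1]).

The Bessel functions [J_0] and [J_1] are bounded by 1, because [J_0^2 + J_1^2] is
non-increasing on the positive half-line and equals 1 at 0 ([bessel_energy]).
The integrand of the forward operator is then dominated by a polynomial times
[e^(-2 h lambda)], and dominated convergence makes the operator sequentially
continuous on the cone ([coil_response_cvg]).

Finally a sequentially continuous function attains its minimum on a compact box
([rV_sequential_min]). *)
Set Implicit Arguments.
Unset Strict Implicit.
Unset Printing Implicit Defensive.

Import Order.TTheory GRing.Theory Num.Theory.
Import numFieldNormedType.Exports.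

Local Open Scope ring_scope.
Local Open Scope complex_scope.
Local Open Scope classical_set_scope.

(** * Coercivity of the discrete Laplacian on the non-negative cone *)

(** The comparison principle for Z-matrices with a positive strict supersolution
[phi]. At the index [i] where [x i / phi i] attains its maximum [c], if [c] is
positive, then [x <= c phi] with equality at [i], and the off-diagonal entries
are non-positive, so [b >= (A x)_i >= c (A phi)_i >= c]. *)
Lemma zmatrix_comparison (R : realFieldType) (k : nat) (A : 'M[R]_k)
    (phi x : 'cV[R]_k) (b : R) :
  (forall i j, i != j -> A i j <= 0) ->
  (forall i, 0 < phi i ord0) -> (forall i, 1 <= (A *m phi) i ord0) ->
  0 <= b -> (forall i, (A *m x) i ord0 <= b) ->
  forall i, x i ord0 <= b * phi i ord0.
Proof.
move=> A_le0 phi_gt0 Aphi b_ge0 Ax i0.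
have [//|i _ imax] := @arg_maxP _ _ _ i0 xpredT (fun j => x j ord0 / phi j ord0).
set c := x i ord0 / phi i ord0 in imax.
suff c_le : c <= b.
  rewrite -ler_pdivrMr//; exact: le_trans (imax i0 isT) _.
have [c_le0|c_gt0] := leP c 0; first exact: le_trans c_le0 b_ge0.
have xphi j : x j ord0 <= c * phi j ord0 by rewrite -ler_pdivrMr//; exact: imax.
have xi : x i ord0 = c * phi i ord0 by rewrite divfK// gt_eqF.
apply: le_trans (Ax i).
apply: (@le_trans _ _ (c * (A *m phi) i ord0)).
  by rewrite ler_peMr// ltW.
rewrite !mxE mulr_sumr; apply: ler_sum => j _.
rewrite mulrCA; have [<-|ij] := eqVneq i j; first by rewrite xi.
by rewrite ler_wnM2l// A_le0.
Qed.

Lemma laplacian1_row (R : pzRingType) (k : nat) (g : nat -> R) (i : 'I_k) :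
  \sum_j laplacian1 R k i j * g j =
  2 * g i - (if (0 < i)%N then g i.-1 else 0)
          - (if (i.+1 < k)%N then g i.+1 else 0).
Proof.
have E j : laplacian1 R k i j * g j =
   (if j == i then 2 * g j else 0) - (if j.+1 == i :> nat then g j else 0)
   - (if i.+1 == j :> nat then g j else 0).
  rewrite mxE; have [<-|ij] := eqVneq i j.
    by rewrite gtn_eqF// ?ltnSn// subr0 subr0.
  have [<-|_] := eqVneq i.+1 (nat_of_ord j).
    by rewrite /= gtn_eqF// subr0 sub0r mulN1r.
  by case: eqVneq => _ /=; rewrite ?sub0r ?subr0 ?mulN1r ?mul0r ?oppr0.
under eq_bigr do rewrite E.
rewrite !sumrB -!big_mkcond big_pred1_eq; congr (_ - _ - _).
  case: ifPn => [i_gt0|]; last first.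
    by rewrite -leqNgt leqn0 => /eqP ->; rewrite big_pred0.
  have ltk : (i.-1 < k)%N by rewrite prednK// ltnW.
  rewrite (big_pred1 (Ordinal ltk)) // => j.
  by rewrite /= -val_eqE /= -[RHS]eqSS prednK.
case: ifPn => [i_ltk|].
  by rewrite (big_pred1 (Ordinal i_ltk)) // => j; rewrite /= -val_eqE /= eq_sym.
rewrite -leqNgt => k_le; rewrite big_pred0 // => j.
by rewrite gtn_eqF// (leq_trans (ltn_ord j)).
Qed.

(** The solution of the discrete Poisson equation with right-hand side 1 and zero
boundary values: with indices starting at 0 the boundary points are [-1] and
[k], and the concave parabola vanishing there has second difference [-1]. *)
Definition parabola (R : realFieldType) (k : nat) : 'cV[R]_k :=
  \col_i (2^-1 * (i.+1%:R * (k%:R - i%:R))).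

Lemma parabola_gt0 (R : realFieldType) (k : nat) i : 0 < parabola R k i ord0.
Proof. by rewrite mxE !mulr_gt0 ?invr_gt0// subr_gt0 ltr_nat. Qed.

Lemma laplacian1_parabola (R : realFieldType) (k : nat) i :
  (laplacian1 R k *m parabola R k) i ord0 = 1.
Proof.
rewrite mxE; under eq_bigr do rewrite [X in _ * X]mxE.
rewrite (laplacian1_row (fun j => 2^-1 * (j.+1%:R * (k%:R - j%:R)))).
case: i => -[|i] ltk /=; (case: ifPn => [_|]; first by field);
  rewrite -leqNgt => lek.
  by have -> : k = 1%N; [apply/eqP; rewrite eqn_leq lek|field].
by have -> : k = i.+2; [apply/eqP; rewrite eqn_leq lek|field].
Qed.

(** The zero boundary conditions only remove negative terms from the row sums, so
constants are supersolutions of the one-dimensional Laplacian. *)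
Lemma laplacian1_const_ge0 (R : realFieldType) (k : nat) i :
  0 <= (laplacian1 R k *m const_mx 1) i (ord0 : 'I_1).
Proof.
rewrite mxE; under eq_bigr do rewrite [X in _ * X]mxE.
rewrite (laplacian1_row (fun=> 1)); case: ifP; case: ifP; lra.
Qed.

(** A strict supersolution of the two-dimensional Laplacian: the parabola in the
vertical direction, constant in the horizontal one. *)
Definition barrier (R : realFieldType) (n N : nat) : 'cV[R]_(N * n) :=
  tensmx (const_mx 1 : 'cV[R]_N) (parabola R n).

Lemma barrierE (R : realFieldType) (n N : nat) k :
  barrier R n N k ord0 = parabola R n (mxtens_unindex k).2 ord0.
Proof. by rewrite !mxE mul1r. Qed.

Lemma tensmx_mul_barrier (R : realFieldType) (n N : nat) (A : 'M[R]_N)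
    (B : 'M[R]_n) i j :
  (tensmx A B *m barrier R n N) (mxtens_index (i, j)) ord0 =
  (A *m const_mx 1) i (ord0 : 'I_1) * (B *m parabola R n) j ord0.
Proof.
have -> : tensmx A B *m barrier R n N = _
  := tensmx_mul A B (const_mx 1 : 'cV[R]_N) (parabola R n).
by rewrite [LHS]mxE mxtens_indexK !ord1.
Qed.

Lemma laplacian_barrier (R : realFieldType) (n N : nat) k :
  1 <= (laplacian R n N *m barrier R n N) k ord0.
Proof.
rewrite /laplacian mulmxDl mxE; case: (mxtens_indexP k) => i j.
rewrite !tensmx_mul_barrier laplacian1_parabola mulr1 !mul1mx.
rewrite [X in _ + X]mxE lerDr mulr_ge0 ?laplacian1_const_ge0//.
exact/ltW/parabola_gt0.
Qed.

Lemma laplacian_offdiag (R : realFieldType) (n N : nat) k l :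
  k != l -> laplacian R n N k l <= 0.
Proof.
case: (mxtens_indexP k) => i j; case: (mxtens_indexP l) => i' j' ij.
rewrite !mxE !mxtens_indexK /=.
have: (i != i') || (j != j').
  by rewrite -negb_and; apply: contra ij => /andP[/eqP-> /eqP->].
by case: (eqVneq i i') => _; case: (eqVneq j j') => _ //= _;
  do ?case: ifP => _; lra.
Qed.

(** The one-sided form of coercivity; on the non-negative cone it bounds every
entry from both sides. *)
Lemma laplacian_le_parabola (R : realFieldType) (n N : nat) (b : R) (S : 'M[R]_(n, N)) :
  0 <= b ->
  (forall k, (discrete_laplacian S) k ord0 <= b) ->
  forall i j, S i j <= b * parabola R n i ord0.
Proof.
move=> b_ge0 Sb i j.
have /= := zmatrix_comparison (@laplacian_offdiag R n N) _
  (@laplacian_barrier R n N) b_ge0 Sb (mxtens_index (j, i)).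
by rewrite barrierE mxE mxtens_indexK; apply => k; rewrite barrierE parabola_gt0.
Qed.

(** * Monotonicity from the sign of the derivative *)

(** The form of the mean value theorem that suits functions differentiable on the
whole line with a sign condition on a half-line only. *)
Lemma is_derive_homo (R : realType) (f df : R -> R) (a b : R) :
  (forall x : R, is_derive x (1 : R) f (df x)) -> (forall x, a <= x -> 0 <= df x) ->
  a <= b -> f a <= f b.
Proof.
move=> fdf df_ge0 ab.
have [|c] := @MVT_segment R f df a b ab.
- apply: continuous_subspaceT => x; apply: differentiable_continuous.
  exact/derivable1_diffP/ex_derive.
- rewrite in_itv/= => /andP[ac _] E.
  by rewrite -subr_ge0 E mulr_ge0 ?df_ge0 ?subr_ge0.
Qed.

(** The derivative of [2 sinh a - 2 a] is [2 cosh a - 2]. *)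
Lemma sinh_ge (R : realType) (a : R) : 0 <= a -> 2 * a <= expR a - expR (- a).
Proof.
move=> a_ge0; rewrite -subr_ge0.
pose f (x : R) := expR x - expR (- x) - 2 * x.
have := @is_derive_homo R f (fun x => expR x + expR (- x) - 2) 0 a _ _ a_ge0.
rewrite /f oppr0 mulr0 subrr subr0; apply.
- by move=> x; apply: is_derive_eq; rewrite /GRing.scale /=; ring.
- by move=> x _; have := expR_ge1Dx x; have := expR_ge1Dx (- x); lra.
Qed.

Lemma normr_sin_le (R : realType) (a : R) : 0 <= a -> `|sin a| <= a.
Proof.
move=> a_ge0; rewrite ler_norml; apply/andP; split.
  have := @is_derive_homo R (fun x => sin x + x) (fun x => cos x + 1) 0 a _ _ a_ge0.
  rewrite sin0 addr0 => H; rewrite -subr_ge0 opprK; apply: H.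
  by move=> x _; have := cos_geN1 x; lra.
have := @is_derive_homo R (fun x => x - sin x) (fun x => 1 - cos x) 0 a _ _ a_ge0.
rewrite sin0 subr0 => H; rewrite -subr_ge0; apply: H.
by move=> x _; have := cos_le1 x; lra.
Qed.

(** * The surface admittance stays in a quadrant *)

Definition quadrant (R : realType) (z : R[i]) : Prop :=
  0 < complex.Re z /\ 0 <= complex.Im z.

(** One step of the admittance recursion, in real coordinates. Here [u = a + i b]
is the wave number of the layer, [y = p + i r] the normalized admittance below
it, and [C], [S], [c], [s] stand for [cosh A], [sinh A], [cos B], [sin B] with
[A + i B] the product of the thickness and [u]. The new admittance is [F / E]
with [E = u cosh + y sinh] and [F = u (y cosh + u sinh)], and [G = F / u]. It
lies in the quadrant when the real part of [F] times the conjugate of [E] is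
positive and the imaginary part is non-negative. Each of these two quantities
expands into four terms, of degrees 0, 1, 1 and 2 in [y]. *)
Section QuadrantStep.
Variable R : realType.
Variables a b p r C S c s : R.
Hypotheses (a_gt0 : 0 < a) (b_ge0 : 0 <= b) (ba : b <= a).
Hypotheses (p_gt0 : 0 < p) (r_ge0 : 0 <= r).
Hypotheses (CS : C ^+ 2 = 1 + S ^+ 2) (cs : c ^+ 2 + s ^+ 2 = 1) (S_gt0 : 0 < S).
Hypothesis bsc : `|b * (s * c)| <= a * (C * S).
Hypothesis asc : `|a * (s * c)| <= b * (C * S).
Hypothesis asbS : a ^+ 2 * s ^+ 2 <= b ^+ 2 * S ^+ 2.

Local Notation Er := (a * C * c - b * S * s + p * S * c - r * C * s).
Local Notation Ei := (a * S * s + b * C * c + p * C * s + r * S * c).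
Local Notation Gr := (p * C * c - r * S * s + a * S * c - b * C * s).
Local Notation Gi := (p * S * s + r * C * c + a * C * s + b * S * c).
Local Notation Fr := (a * Gr - b * Gi).
Local Notation Fi := (a * Gi + b * Gr).

(** The terms of degree 0 and 2 in [y] are non-negative since [b |s c| <= a C S].
One of the two terms of degree 1 is [|u|^2 Re y |cosh|^2], the strictly positive
one; the other is a multiple of the real part of [u^2] times the conjugate of
[y], and is non-negative because [u^2] and [y] both lie in the closed first
quadrant. *)
Lemma step_Re_gt0 : 0 < Fr * Er + Fi * Ei.
Proof.
have -> : Fr * Er + Fi * Ei =
  (a ^+ 2 + b ^+ 2) * (a * (C * S) * (c ^+ 2 + s ^+ 2) - b * (s * c) * (C ^+ 2 - S ^+ 2))
  + (a ^+ 2 + b ^+ 2) * p * (C ^+ 2 * c ^+ 2 + S ^+ 2 * s ^+ 2)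
  + ((a ^+ 2 - b ^+ 2) * p + 2 * a * b * r) * (S ^+ 2 * c ^+ 2 + C ^+ 2 * s ^+ 2)
  + (p ^+ 2 + r ^+ 2) * (a * (C * S) * (c ^+ 2 + s ^+ 2) + b * (s * c) * (C ^+ 2 - S ^+ 2)).
  by ring.
have -> : C ^+ 2 - S ^+ 2 = 1 by rewrite CS addrK.
rewrite cs !mulr1.
have X1 : 0 <= a * (C * S) - b * (s * c) by move: bsc asc; rewrite !ler_norml; lra.
have X2 : 0 <= a * (C * S) + b * (s * c) by move: bsc asc; rewrite !ler_norml; lra.
have X3 : 0 < C ^+ 2 * c ^+ 2 + S ^+ 2 * s ^+ 2.
  rewrite CS mulrDl mul1r -addrA -mulrDr cs mulr1.
  by rewrite ltr_wpDl ?sqr_ge0 ?exprn_gt0.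
have X4 : 0 <= (a ^+ 2 - b ^+ 2) * p + 2 * a * b * r.
  rewrite addr_ge0 ?mulr_ge0 ?(ltW a_gt0) ?(ltW p_gt0)// subr_ge0.
  by rewrite ler_pXn2r ?nnegrE ?(ltW a_gt0).
have ab : 0 < a ^+ 2 + b ^+ 2 by rewrite ltr_wpDr ?sqr_ge0 ?exprn_gt0.
have T1 := mulr_ge0 (ltW ab) X1.
have T2 := mulr_gt0 (mulr_gt0 ab p_gt0) X3.
have T3 : 0 <= S ^+ 2 * c ^+ 2 + C ^+ 2 * s ^+ 2.
  by rewrite addr_ge0// mulr_ge0// sqr_ge0.
have T4 := mulr_ge0 X4 T3.
have T5 : 0 <= p ^+ 2 + r ^+ 2 by rewrite addr_ge0 ?sqr_ge0.
have T6 := mulr_ge0 T5 X2.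
lra.
Qed.

(** The terms of degree 0 and 2 in [y] are non-negative since [a |s c| <= b C S].
In degree 1 the coefficient of [r] contains a negative contribution from
[Re (u^2) |sinh|^2], which is absorbed by [|u|^2 |cosh|^2] thanks to
[a^2 s^2 <= b^2 S^2]. *)
Lemma step_Im_ge0 : 0 <= Fi * Er - Fr * Ei.
Proof.
have -> : Fi * Er - Fr * Ei =
  (a ^+ 2 + b ^+ 2) * (a * (s * c) * (C ^+ 2 - S ^+ 2) + b * (C * S) * (c ^+ 2 + s ^+ 2))
  + (a ^+ 2 + b ^+ 2) * r * (C ^+ 2 * c ^+ 2 + S ^+ 2 * s ^+ 2)
  + (2 * a * b * p - (a ^+ 2 - b ^+ 2) * r) * (S ^+ 2 * c ^+ 2 + C ^+ 2 * s ^+ 2)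
  + (p ^+ 2 + r ^+ 2) * (b * (C * S) * (c ^+ 2 + s ^+ 2) - a * (s * c) * (C ^+ 2 - S ^+ 2)).
  by ring.
have -> : C ^+ 2 - S ^+ 2 = 1 by rewrite CS addrK.
rewrite cs !mulr1.
have X1 : 0 <= a * (s * c) + b * (C * S) by move: bsc asc; rewrite !ler_norml; lra.
have X2 : 0 <= b * (C * S) - a * (s * c) by move: bsc asc; rewrite !ler_norml; lra.
have X3 : 0 <= S ^+ 2 * c ^+ 2 + C ^+ 2 * s ^+ 2.
  by rewrite addr_ge0// mulr_ge0// sqr_ge0.
have ab : 0 <= a ^+ 2 + b ^+ 2 by rewrite addr_ge0 ?sqr_ge0.
have X4 : 0 <= (a ^+ 2 + b ^+ 2) * (C ^+ 2 * c ^+ 2 + S ^+ 2 * s ^+ 2)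
   - (a ^+ 2 - b ^+ 2) * (S ^+ 2 * c ^+ 2 + C ^+ 2 * s ^+ 2).
  have -> : c ^+ 2 = 1 - s ^+ 2 by rewrite -cs addrK.
  rewrite CS (_ : _ - _ = 2 * (b ^+ 2 * S ^+ 2 - a ^+ 2 * s ^+ 2)
    + (a ^+ 2 + b ^+ 2)); last by ring.
  by rewrite addr_ge0// mulr_ge0// subr_ge0.
have X5 : 0 <= 2 * a * b * p * (S ^+ 2 * c ^+ 2 + C ^+ 2 * s ^+ 2).
  by rewrite !mulr_ge0 ?(ltW a_gt0) ?(ltW p_gt0).
have T5 : 0 <= p ^+ 2 + r ^+ 2 by rewrite addr_ge0 ?sqr_ge0.
have T1 := mulr_ge0 ab X1; have T4 := mulr_ge0 r_ge0 X4.
have T6 := mulr_ge0 T5 X2; lra.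
Qed.
End QuadrantStep.

Lemma re_add (R : realType) (x y : R[i]) :
  complex.Re (x + y) = complex.Re x + complex.Re y.
Proof. by case: x; case: y. Qed.
Lemma im_add (R : realType) (x y : R[i]) :
  complex.Im (x + y) = complex.Im x + complex.Im y.
Proof. by case: x; case: y. Qed.
Lemma re_opp (R : realType) (x : R[i]) : complex.Re (- x) = - complex.Re x.
Proof. by case: x. Qed.
Lemma im_opp (R : realType) (x : R[i]) : complex.Im (- x) = - complex.Im x.
Proof. by case: x. Qed.
Lemma re_mul (R : realType) (x y : R[i]) :
  complex.Re (x * y) = complex.Re x * complex.Re y - complex.Im x * complex.Im y.
Proof. by case: x; case: y. Qed.
Lemma im_mul (R : realType) (x y : R[i]) :
  complex.Im (x * y) = complex.Re x * complex.Im y + complex.Im x * complex.Re y.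
Proof. by case: x; case: y. Qed.
Lemma re_inv (R : realType) (x : R[i]) :
  complex.Re x^-1 = complex.Re x / (complex.Re x ^+ 2 + complex.Im x ^+ 2).
Proof. by case: x. Qed.
Lemma im_inv (R : realType) (x : R[i]) :
  complex.Im x^-1 = - (complex.Im x / (complex.Re x ^+ 2 + complex.Im x ^+ 2)).
Proof. by case: x. Qed.
Definition re_imE := (re_add, im_add, re_opp, im_opp, re_mul, im_mul).

Lemma sqr_modulus_gt0 (R : realType) (x : R[i]) : x != 0 ->
  0 < complex.Re x ^+ 2 + complex.Im x ^+ 2.
Proof.
case: x => a b; rewrite eq_complex negb_and /= => ab.
rewrite lt_neqAle addr_ge0 ?sqr_ge0// eq_sym paddr_eq0 ?sqr_ge0//.
by rewrite !sqrf_eq0 negb_and ab.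
Qed.

Lemma quadrant_div (R : realType) (F E : R[i]) :
  0 < complex.Re F * complex.Re E + complex.Im F * complex.Im E ->
  0 <= complex.Im F * complex.Re E - complex.Re F * complex.Im E ->
  E != 0 /\ quadrant (F / E).
Proof.
move=> FE_gt0 FE_ge0; have E0 : E != 0.
  by apply: contraTneq FE_gt0 => ->; rewrite /= !mulr0 addr0 ltxx.
split=> //; rewrite /quadrant !re_imE re_inv im_inv.
have E2 := sqr_modulus_gt0 E0; set m := _ + _ in E2 *.
by split; [rewrite (_ : _ - _ =
   (complex.Re F * complex.Re E + complex.Im F * complex.Im E) / m) ?divr_gt0//
 | rewrite (_ : _ + _ =
   (complex.Im F * complex.Re E - complex.Re F * complex.Im E) / m) ?divr_ge0 ?(ltW E2)//];
  field; rewrite gt_eqF.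
Qed.

(** The denominator of [tanhC], kept without the factor 1/2 so that [tanhC] is
literally the quotient of the two functions. *)
Definition twice_coshC (R : realType) (z : R[i]) := expC z + expC (- z).
Definition twice_sinhC (R : realType) (z : R[i]) := expC z - expC (- z).
(** Where the wave numbers of the layers live: the square root of a number of the
first quadrant has its argument between 0 and pi/4. *)
Definition sector (R : realType) (u : R[i]) : Prop :=
  quadrant u /\ complex.Im u <= complex.Re u.

(** The quadrant is invariant under the admittance recursion. The two non-vanishing
denominators are what continuity of the recursion requires. All the inequalities
on hyperbolic and trigonometric functions reduce to [sinh x >= x] and
[|sin x| <= x], used at [A], [B], [2 A] and [2 B]; they combine because [A] and
[B] are the same multiple of [a] and [b]. *)
Lemma admittance_step (R : realType) (d : R) (u y : R[i]) :
  0 < d -> sector u -> quadrant y ->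
  let t := tanhC (d%:C * u) in
  [/\ twice_coshC (d%:C * u) != 0, u + y * t != 0 &
      quadrant (u * ((y + u * t) / (u + y * t)))].
Proof.
move=> d_gt0; case: u => a b; case: y => p r [[/= a_gt0 b_ge0] ba] [/= p_gt0 r_ge0].
set t := tanhC _.
pose A := d * a; pose B := d * b.
have A_gt0 : 0 < A by rewrite mulr_gt0.
have B_ge0 : 0 <= B by rewrite mulr_ge0// ltW.
pose C := (expR A + expR (- A)) / 2; pose S := (expR A - expR (- A)) / 2.
pose c := cos B; pose s := sin B.
have Uz : d%:C * (a +i* b) = A +i* B.
  by apply/eqP; rewrite eq_complex /= !mul0r subr0 addr0 !eqxx.
have chE : twice_coshC (A +i* B) = (2 * C * c) +i* (2 * S * s).
  apply/eqP; rewrite eq_complex /twice_coshC /expC /C /S /c /s !re_imE /= cosN sinN.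
  by apply/andP; split; apply/eqP; lra.
have shE : twice_sinhC (A +i* B) = (2 * S * c) +i* (2 * C * s).
  apply/eqP; rewrite eq_complex /twice_sinhC /expC /C /S /c /s !re_imE /= cosN sinN.
  by apply/andP; split; apply/eqP; lra.
have tE : t = twice_sinhC (A +i* B) / twice_coshC (A +i* B) by rewrite /t Uz.
have CS : C ^+ 2 = 1 + S ^+ 2.
  have E : expR A * expR (- A) = 1 by rewrite expRN divff// gt_eqF ?expR_gt0.
  by rewrite (_ : C ^+ 2 = expR A * expR (- A) + S ^+ 2) ?E// /C /S; lra.
have cs : c ^+ 2 + s ^+ 2 = 1 by exact: cos2Dsin2.
have AS : A <= S by rewrite /S ler_pdivlMr// mulrC sinh_ge// ltW.
have S_gt0 : 0 < S by exact: lt_le_trans AS.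
have ACS : A <= C * S.
  have A2 : 0 <= 2 * A by rewrite mulr_ge0 ?(ltW A_gt0).
  have := sinh_ge A2; rewrite (_ : 2 * A = A + A) ?opprD ?expRD /C /S; lra.
have sB : `|s| <= B by exact: normr_sin_le.
have scB : `|s * c| <= B.
  have B2 : 0 <= 2 * B by rewrite mulr_ge0.
  have := normr_sin_le B2; rewrite (_ : 2 * B = B + B) ?sinD -/s -/c; last by lra.
  by rewrite !ler_norml; lra.
have d_ge0 := ltW d_gt0; have a_ge0 := ltW a_gt0.
have bsc : `|b * (s * c)| <= a * (C * S).
  rewrite normrM (ger0_norm b_ge0).
  apply: (le_trans (ler_wpM2l b_ge0 scB)).
  apply: le_trans (ler_wpM2l a_ge0 ACS).
  by rewrite /A /B mulrCA [leRHS]mulrCA ler_wpM2l// ler_pM.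
have asc : `|a * (s * c)| <= b * (C * S).
  rewrite normrM (ger0_norm a_ge0).
  apply: (le_trans (ler_wpM2l a_ge0 scB)).
  apply: le_trans (ler_wpM2l b_ge0 ACS).
  by rewrite /A /B mulrCA [leRHS]mulrCA ler_wpM2l// mulrC.
have asbS : a ^+ 2 * s ^+ 2 <= b ^+ 2 * S ^+ 2.
  have bS : 0 <= b * S by rewrite mulr_ge0// ltW.
  rewrite -!exprMn -[leLHS]real_normK ?num_real// ler_pXn2r ?nnegrE//.
  rewrite normrM (ger0_norm a_ge0); apply: (le_trans (ler_wpM2l a_ge0 sB)).
  apply: le_trans (ler_wpM2l b_ge0 AS).
  by rewrite /A /B mulrCA [leRHS]mulrCA ler_wpM2l// mulrC.
have HRe := step_Re_gt0 a_gt0 b_ge0 ba p_gt0 r_ge0 CS cs S_gt0 bsc asc.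
have HIm := step_Im_ge0 a_gt0 b_ge0 p_gt0 r_ge0 CS cs bsc asc asbS.
clearbody C S c s.
have ch0 : twice_coshC (A +i* B) != 0.
  rewrite chE; apply/eqP => -[/eqP + /eqP]; rewrite !mulf_eq0 !pnatr_eq0.
  rewrite (gt_eqF S_gt0) /= => /orP[/eqP C0|/eqP c0] /eqP s0.
    by have := sqr_ge0 S; move: CS; rewrite C0; lra.
  by move: cs; rewrite c0 s0; lra.
set u := a +i* b; set y := p +i* r.
have [||E0 Q] := @quadrant_div R
  (u * (y * twice_coshC (A +i* B) + u * twice_sinhC (A +i* B)))
  (u * twice_coshC (A +i* B) + y * twice_sinhC (A +i* B)).
- rewrite chE shE /u /y !re_imE /=.
  by move: HRe; lra.
- by rewrite chE shE /u /y !re_imE /=; move: HIm; lra.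
have E1 : u + y * t =
    (u * twice_coshC (A +i* B) + y * twice_sinhC (A +i* B)) / twice_coshC (A +i* B).
  by rewrite tE mulrA -{1}(mulfK ch0 u) mulrDl.
have E2 : y + u * t =
    (y * twice_coshC (A +i* B) + u * twice_sinhC (A +i* B)) / twice_coshC (A +i* B).
  by rewrite tE mulrA -{1}(mulfK ch0 y) mulrDl.
split; first by rewrite Uz.
  by rewrite E1 mulf_neq0// invr_eq0.
by rewrite E1 E2 invf_div [X in u * X]mulrA divfK// mulrA.
Qed.

Lemma sqrtc_sector (R : realType) (a b : R) : 0 < a -> 0 <= b ->
  sector (sqrtc (a +i* b)).
Proof.
move=> a_gt0 b_ge0; rewrite /sector /quadrant /=.
have ar : a <= Num.sqrt (a ^+ 2 + b ^+ 2).
  by rewrite -{1}(gtr0_norm a_gt0) -sqrtr_sqr ler_wsqrtr// lerDl sqr_ge0.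
have -> : (if b == 0 then 1 else Num.sg b) = 1.
  by case: ifPn => // b0; rewrite gtr0_sg// lt_neqAle eq_sym b0.
rewrite mul1r sqrtr_gt0 sqrtr_ge0 ler_sqrt; first by split; [split|]; lra.
by lra.
Qed.

Lemma layer_u_sqrtc (R : realType) (omega lambda sigma : R) :
  layer_u omega lambda sigma = sqrtc (lambda ^+ 2 +i* (sigma * mu0 * omega)).
Proof.
congr sqrtc; apply/eqP.
by rewrite eq_complex !re_imE /= !mul0r !mul1r subrr !addr0 !add0r !eqxx.
Qed.

Lemma mu0_gt0 (R : realType) : 0 < mu0 :> R.
Proof. by rewrite /mu0 !mulr_gt0 ?pi_gt0// invr_gt0 exprn_gt0. Qed.

Lemma layer_u_sector (R : realType) (omega lambda sigma : R) :
  0 < omega -> 0 < lambda -> 0 <= sigma -> sector (layer_u omega lambda sigma).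
Proof.
move=> om_gt0 la_gt0 si_ge0; rewrite layer_u_sqrtc; apply: sqrtc_sector.
  by rewrite exprn_gt0.
by apply: mulr_ge0 (ltW om_gt0); apply: mulr_ge0 si_ge0 (ltW (mu0_gt0 R)).
Qed.

Lemma i_mu0_omega_neq0 (R : realType) (omega : R) : 0 < omega ->
  'i%C * (mu0 * omega)%:C != 0 :> R[i].
Proof.
move=> om_gt0; apply/eqP => /(congr1 (@complex.Im _)).
rewrite im_mul /= mul0r mul1r add0r => /eqP.
by rewrite gt_eqF// mulr_gt0// mu0_gt0.
Qed.

(** The surface admittance multiplied by [i mu0 omega]. This normalization removes
the constant from the recursion and turns the reflection factor into
[(lambda - y) / (lambda + y)]. *)
Fixpoint wave_number {R : realType} (omega lambda : R) (n : nat) :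
    ('I_n -> R) -> ('I_n.+1 -> R) -> R[i] :=
  if n is n'.+1 then fun d sigma =>
    let u := layer_u omega lambda (sigma ord0) in
    let y := wave_number omega lambda (fun i => d (lift ord0 i))
                                      (fun i => sigma (lift ord0 i)) in
    let t := tanhC ((d ord0)%:C * u) in
    u * ((y + u * t) / (u + y * t))
  else fun _ sigma => layer_u omega lambda (sigma ord0).

Lemma admittanceE (R : realType) (omega lambda : R) n (d : 'I_n -> R) sigma :
  0 < omega ->
  admittance omega lambda d sigma =
  wave_number omega lambda d sigma / ('i%C * (mu0 * omega)%:C).
Proof.
move=> om_gt0; set k := 'i%C * (mu0 * omega)%:C.
have k0 : k != 0 by exact: i_mu0_omega_neq0.
elim: n d sigma => [//|n IHn] d sigma /=; rewrite IHn /layer_N -/k.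
have mk x z : x / k * z = x * z / k by exact: mulrAC.
rewrite !mk -!mulrDl invf_div; congr (_ * _ / _).
by rewrite mulrA divfK.
Qed.

Lemma wave_number_quadrant (R : realType) (omega lambda : R) n
    (d : 'I_n -> R) (sigma : 'I_n.+1 -> R) :
  0 < omega -> 0 < lambda -> (forall i, 0 < d i) -> (forall i, 0 <= sigma i) ->
  quadrant (wave_number omega lambda d sigma).
Proof.
move=> om_gt0 la_gt0; elim: n d sigma => [|n IHn] d sigma d_gt0 s_ge0 /=.
  by case: (layer_u_sector om_gt0 la_gt0 (s_ge0 ord0)).
have y2 := IHn (fun i => d (lift ord0 i)) (fun i => sigma (lift ord0 i))
  (fun i => d_gt0 _) (fun i => s_ge0 _).
by have [] := admittance_step (d_gt0 ord0)
  (layer_u_sector om_gt0 la_gt0 (s_ge0 ord0)) y2.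
Qed.

Lemma reflectionE (R : realType) (omega lambda : R) n
    (d : 'I_n -> R) (sigma : 'I_n.+1 -> R) : 0 < omega ->
  reflection d sigma omega lambda =
  (lambda%:C - wave_number omega lambda d sigma) /
  (lambda%:C + wave_number omega lambda d sigma).
Proof.
move=> om_gt0; rewrite /reflection admittanceE// /air_N; set k := 'i%C * (mu0 * omega)%:C.
have k0 : k != 0 by exact: i_mu0_omega_neq0.
by rewrite -mulrBl -mulrDl invf_div mulrA divfK.
Qed.

(** The squared modulus as a real number; the norm of [R[i]] takes its values in
[R[i]]. *)
Definition sqmod (R : realType) (z : R[i]) : R :=
  complex.Re z ^+ 2 + complex.Im z ^+ 2.

Lemma sqmodM (R : realType) (z w : R[i]) : sqmod (z * w) = sqmod z * sqmod w.
Proof. by rewrite /sqmod !re_imE; ring. Qed.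

Lemma sqmodV (R : realType) (z : R[i]) : sqmod z^-1 = (sqmod z)^-1.
Proof.
have [->|z0] := eqVneq z 0.
  by rewrite invr0 /sqmod /= expr0n addr0 invr0.
have := sqr_modulus_gt0 z0; rewrite /sqmod re_inv im_inv => m_gt0.
by field; rewrite gt_eqF.
Qed.

(** A number of positive real part is closer to [lambda > 0] than to [-lambda]. *)
Lemma reflection_le1 (R : realType) (omega lambda : R) n
    (d : 'I_n -> R) (sigma : 'I_n.+1 -> R) :
  0 < omega -> 0 < lambda -> (forall i, 0 < d i) -> (forall i, 0 <= sigma i) ->
  complex.Re (reflection d sigma omega lambda) ^+ 2 +
  complex.Im (reflection d sigma omega lambda) ^+ 2 <= 1.
Proof.
move=> om_gt0 la_gt0 d_gt0 s_ge0; rewrite reflectionE//.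
have [] := wave_number_quadrant om_gt0 la_gt0 d_gt0 s_ge0.
set w := wave_number _ _ _ _; move=> x_gt0 y_ge0.
rewrite -[leLHS]/(sqmod _) sqmodM sqmodV ler_pdivrMr.
  rewrite mul1r /sqmod !re_imE /=; nra.
by apply: sqr_modulus_gt0; apply/eqP => /(congr1 (@complex.Re _)); rewrite re_add /=; lra.
Qed.

(** * Continuity of the reflection factor *)

(** Convergence in the plane, stated on real and imaginary parts so that it feeds
directly into real integrals. The filter is arbitrary: sequences give continuity
in the conductivities, neighbourhoods of a point give measurability in
[lambda]. *)
Definition cvgC (R : realType) (T : Type) (F : set_system T) (f : T -> R[i])
    (l : R[i]) : Prop :=
  (complex.Re (f t) @[t --> F] --> complex.Re l) /\
  (complex.Im (f t) @[t --> F] --> complex.Im l).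

Section CvgC.
Variables (R : realType) (T : Type) (F : set_system T).
Hypothesis FF : Filter F.
Implicit Types (f g : T -> R[i]) (a b : R[i]).

Lemma cvgC_cst a : cvgC F (fun=> a) a.
Proof. by split; exact: cvg_cst. Qed.

Lemma cvgC_real (f : T -> R) (a : R) :
  f t @[t --> F] --> a -> cvgC F (fun t => (f t)%:C) a%:C.
Proof. by move=> fa; split=> //=; exact: cvg_cst. Qed.

Lemma cvgC_add f g a b : cvgC F f a -> cvgC F g b ->
  cvgC F (fun t => f t + g t) (a + b).
Proof.
move=> [f1 f2] [g1 g2]; split; rewrite re_imE; under eq_fun do rewrite re_imE.
  exact: cvgD.
exact: cvgD.
Qed.

Lemma cvgC_opp f a : cvgC F f a -> cvgC F (fun t => - f t) (- a).
Proof.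
move=> [f1 f2]; split; rewrite re_imE; under eq_fun do rewrite re_imE; exact: cvgN.
Qed.

Lemma cvgC_mul f g a b : cvgC F f a -> cvgC F g b ->
  cvgC F (fun t => f t * g t) (a * b).
Proof.
move=> [f1 f2] [g1 g2]; split; rewrite re_imE; under eq_fun do rewrite re_imE.
  by apply: cvgB; exact: cvgM.
by apply: cvgD; exact: cvgM.
Qed.

Lemma cvgC_inv f a : a != 0 -> cvgC F f a -> cvgC F (fun t => (f t)^-1) a^-1.
Proof.
move=> a0 [f1 f2].
have m0 := lt0r_neq0 (sqr_modulus_gt0 a0).
have cm : (complex.Re (f t) ^+ 2 + complex.Im (f t) ^+ 2)^-1 @[t --> F] -->
   (complex.Re a ^+ 2 + complex.Im a ^+ 2)^-1.
  apply: cvgV => //.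
  by apply: cvgD; rewrite expr2; under eq_fun do rewrite expr2; exact: cvgM.
split.
  by rewrite re_inv; under eq_fun do rewrite re_inv; exact: cvgM f1 cm.
by rewrite im_inv; under eq_fun do rewrite im_inv; exact: cvgN (cvgM f2 cm).
Qed.

Lemma cvgC_expC f a : cvgC F f a -> cvgC F (fun t => expC (f t)) (expC a).
Proof.
move=> [f1 f2]; apply: cvgC_mul.
  by apply: cvgC_real; apply: continuous_cvg f1; exact: continuous_expR.
split=> /=; apply: continuous_cvg f2.
  exact: continuous_cos.
exact: continuous_sin.
Qed.

Lemma cvgC_tanhC f a : twice_coshC a != 0 -> cvgC F f a ->
  cvgC F (fun t => tanhC (f t)) (tanhC a).
Proof.
move=> ch0 fa; have e1 := cvgC_expC fa; have e2 := cvgC_expC (cvgC_opp fa).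
apply: cvgC_mul; first by apply: cvgC_add => //; exact: cvgC_opp.
by apply: cvgC_inv => //; exact: cvgC_add.
Qed.

(** The principal square root jumps across the negative real axis; staying in the
closed upper half-plane keeps the sign in its definition constant. *)
Lemma cvgC_sqrtc (f g : T -> R) (a b : R) : (forall t, 0 <= g t) -> 0 <= b ->
  f t @[t --> F] --> a -> g t @[t --> F] --> b ->
  cvgC F (fun t => sqrtc (f t +i* g t)) (sqrtc (a +i* b)).
Proof.
move=> g_ge0 b_ge0 fa gb.
(* On the upper half-plane the square root is a composition of continuous maps. *)
have E x y : 0 <= y -> sqrtc (x +i* y) =
   Num.sqrt ((Num.sqrt (x ^+ 2 + y ^+ 2) + x) / 2) +i*
   Num.sqrt ((Num.sqrt (x ^+ 2 + y ^+ 2) - x) / 2) :> R[i].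
  move=> y_ge0; rewrite /= (_ : (if y == 0 then 1 else Num.sg y) = 1) ?mul1r//.
  by case: ifPn => // y0; rewrite gtr0_sg// lt_neqAle eq_sym y0.
rewrite E//; under eq_fun do rewrite E//.
have cr : Num.sqrt (f t ^+ 2 + g t ^+ 2) @[t --> F] --> Num.sqrt (a ^+ 2 + b ^+ 2).
  apply: continuous_cvg; first exact: sqrt_continuous.
  by apply: cvgD; rewrite expr2; under eq_fun do rewrite expr2; exact: cvgM.
split=> /=; (apply: continuous_cvg; first exact: sqrt_continuous);
  apply: cvgM; try exact: cvg_cst.
  exact: cvgD.
exact: cvgB.
Qed.

Lemma cvgC_layer_u (omega la si : R) (L S : T -> R) : 0 < omega ->
  L t @[t --> F] --> la -> S t @[t --> F] --> si ->
  (forall t, 0 <= S t) -> 0 <= si ->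
  cvgC F (fun t => layer_u omega (L t) (S t)) (layer_u omega la si).
Proof.
move=> om_gt0 cL cS S_ge0 s_ge0.
rewrite layer_u_sqrtc; under eq_fun do rewrite layer_u_sqrtc.
have mo_ge0 := ltW om_gt0; have mu_ge0 := ltW (mu0_gt0 R).
apply: cvgC_sqrtc.
- by move=> t; apply: mulr_ge0 => //; exact: mulr_ge0.
- by apply: mulr_ge0 => //; exact: mulr_ge0.
- by rewrite expr2; under eq_fun do rewrite expr2; exact: cvgM.
- by apply: cvgM; [apply: cvgM => //|]; exact: cvg_cst.
Qed.

Lemma cvgC_wave_number n (omega la : R) (L : T -> R) (d : 'I_n -> R)
    (si : 'I_n.+1 -> R) (S : T -> 'I_n.+1 -> R) :
  0 < omega -> 0 < la -> (forall i, 0 < d i) ->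
  (forall t i, 0 <= S t i) -> (forall i, 0 <= si i) ->
  L t @[t --> F] --> la -> (forall i, S t i @[t --> F] --> si i) ->
  cvgC F (fun t => wave_number omega (L t) d (S t)) (wave_number omega la d si).
Proof.
move=> om_gt0 la_gt0; elim: n d si S => [|n IHn] d si S d_gt0 S_ge0 s_ge0 cL cS /=.
  exact: cvgC_layer_u.
pose d' i := d (lift ord0 i); pose si' i := si (lift ord0 i).
have cu : cvgC F (fun t => layer_u omega (L t) (S t ord0)) (layer_u omega la (si ord0)).
  exact: cvgC_layer_u.
have cy := IHn d' si' (fun t i => S t (lift ord0 i)) (fun i => d_gt0 _)
  (fun t i => S_ge0 _ _) (fun i => s_ge0 _) cL (fun i => cS _).
have y2 := @wave_number_quadrant R omega la _ d' si' om_gt0 la_gt0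
  (fun i => d_gt0 _) (fun i => s_ge0 _).
have [ch0 E0 _] := admittance_step (d_gt0 ord0)
  (layer_u_sector om_gt0 la_gt0 (s_ge0 ord0)) y2.
have ct := cvgC_tanhC ch0 (cvgC_mul (cvgC_cst _) cu).
apply: cvgC_mul => //; apply: cvgC_mul.
  by apply: cvgC_add => //; exact: cvgC_mul.
by apply: cvgC_inv => //; apply: cvgC_add => //; exact: cvgC_mul.
Qed.

Lemma cvgC_reflection n (omega la : R) (L : T -> R) (d : 'I_n -> R)
    (si : 'I_n.+1 -> R) (S : T -> 'I_n.+1 -> R) :
  0 < omega -> 0 < la -> (forall i, 0 < d i) ->
  (forall t i, 0 <= S t i) -> (forall i, 0 <= si i) ->
  L t @[t --> F] --> la -> (forall i, S t i @[t --> F] --> si i) ->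
  cvgC F (fun t => reflection d (S t) omega (L t)) (reflection d si omega la).
Proof.
move=> om_gt0 la_gt0 d_gt0 S_ge0 s_ge0 cL cS.
rewrite reflectionE//; under eq_fun do rewrite reflectionE//.
have cw := cvgC_wave_number om_gt0 la_gt0 d_gt0 S_ge0 s_ge0 cL cS.
have cl := cvgC_real cL.
apply: cvgC_mul; first by apply: cvgC_add => //; exact: cvgC_opp.
apply: cvgC_inv; last exact: cvgC_add.
have [w_gt0 _] := wave_number_quadrant om_gt0 la_gt0 d_gt0 s_ge0.
by apply/eqP => /(congr1 (@complex.Re _)); rewrite re_add /=; lra.
Qed.

End CvgC.

(** * Bessel functions are bounded *)

Definition bessel_coef (R : realType) (nu k : nat) : R :=
  (-1) ^+ k / (k`! * (k + nu)`!)%:R.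

(** The entire function [f_nu] such that [J_nu x = (x/2)^nu f_nu (x^2/4)]. *)
Definition bessel_series (R : realType) (nu : nat) (t : R) : R :=
  limn (pseries (bessel_coef R nu) t).

Lemma normr_bessel_coef (R : realType) nu k : `|bessel_coef R nu k| <= k`!%:R^-1.
Proof.
rewrite /bessel_coef normrM normrX normrN1 expr1n mul1r normfV normr_nat.
rewrite lef_pV2 ?posrE ?ltr0n ?muln_gt0 ?fact_gt0//.
by rewrite ler_nat leq_pmulr// fact_gt0.
Qed.

Lemma pseries_diffs_bessel (R : realType) nu :
  pseries_diffs (bessel_coef R nu) = fun k => - bessel_coef R nu.+1 k.
Proof.
apply/funext => k; rewrite /pseries_diffs /bessel_coef.
rewrite factS -mulnA natrM invfM addSnnS exprS mulN1r mulNr mulrN.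
by congr (- _); rewrite mulrCA mulVKf// pnatr_eq0.
Qed.

(** The coefficients are dominated by those of the exponential series. *)
Lemma is_cvg_bessel_series (R : realType) nu (t : R) :
  cvgn (pseries (bessel_coef R nu) t).
Proof.
apply: normed_cvg; apply: (@series_le_cvg _ _ (exp_coeff `|t|)).
- by move=> k; exact: normr_ge0.
- by move=> k; apply: exp_coeff_ge0.
- move=> k; rewrite /= /exp_coeff normrM normrX mulrC ler_wpM2l//.
  exact: normr_bessel_coef.
- exact: is_cvg_series_exp_coeff.
Qed.

Lemma pseriesN (R : realType) (f : nat -> R) t :
  pseries (fun k => - f k) t = - pseries f t.
Proof.
apply/funext => n; rewrite /pseries /series /= [RHS]/GRing.opp /= -sumrN.
by apply: eq_bigr => k _; rewrite mulNr.
Qed.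

Lemma is_derive_bessel_series (R : realType) nu (t : R) :
  is_derive t (1 : R) (bessel_series nu) (- bessel_series nu.+1 t).
Proof.
have := @pseries_snd_diffs R (bessel_coef R nu) (`|t| + 1) t.
rewrite !pseries_diffs_bessel.
rewrite (_ : pseries_diffs _ = bessel_coef R nu.+2); last first.
  apply/funext => k; have /(congr1 (fun f => f k)) := pseries_diffs_bessel R nu.+1.
  by rewrite /pseries_diffs /= mulrN => ->; rewrite opprK.
rewrite !pseriesN => H.
have := H (@is_cvg_bessel_series R _ _) (is_cvgN (@is_cvg_bessel_series R _ _))
  (@is_cvg_bessel_series R _ _).
rewrite limN//; last exact: is_cvg_bessel_series.
by apply; rewrite [ltRHS]ger0_norm ?ltrDl// addr_ge0.
Qed.

(** The three-term recurrence of Bessel functions, and equivalently, given the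
derivative above, the Bessel equation. *)
Lemma bessel_series_rec (R : realType) nu (t : R) :
  t * bessel_series nu.+2 t = nu.+1%:R * bessel_series nu.+1 t - bessel_series nu t.
Proof.
have c2 := @is_cvg_bessel_series R nu.+2 t.
have c1 := @is_cvg_bessel_series R nu.+1 t.
have c0 := @is_cvg_bessel_series R nu t.
have L : t * pseries (bessel_coef R nu.+2) t n @[n --> \oo] --> t * bessel_series nu.+2 t.
  exact: cvgMr.
apply: (cvg_unique _ L) => //.
pose v n := nu.+1%:R * pseries (bessel_coef R nu.+1) t n - pseries (bessel_coef R nu) t n.
have Lv : v n @[n --> \oo] --> nu.+1%:R * bessel_series nu.+1 t - bessel_series nu t.
  by apply: cvgB => //; exact: cvgMr.
rewrite (_ : (fun n => _) = fun n => v n.+1); first by move: Lv; rewrite -(cvg_shiftS v).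
apply/funext => n; rewrite /v /pseries /series /= !big_nat_recl//=.
rewrite mulrDr !mulr_sumr opprD addrACA -sumrB.
have nz k : k.+1%:R != 0 :> R by rewrite pnatr_eq0.
have fz k : k`!%:R != 0 :> R by rewrite pnatr_eq0 -lt0n fact_gt0.
rewrite [X in _ = X + _](_ : _ = 0) ?add0r.
  apply: eq_bigr => k _; rewrite /bessel_coef !addSn !addnS !factS !natrM !exprS.
  have -> : (k + nu).+2%:R = k.+1%:R + nu.+1%:R :> R by rewrite -natrD addSn addnS.
  have h : k.+1%:R + nu.+1%:R != 0 :> R by rewrite -natrD pnatr_eq0.
  move: (nz k) (nz (k + nu)%N) (fz k) (fz (k + nu)%N) h.
  move: (k.+1%:R) (nu.+1%:R) ((k + nu).+1%:R) (k`!%:R) ((k + nu)`!%:R).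
  move: ((-1) ^+ k) (t ^+ k) => p q k1 n1 kn1 fk fkn k1_0 kn1_0 fk_0 fkn_0 h.
  by field; rewrite ?k1_0 ?kn1_0 ?fk_0 ?fkn_0 ?h.
rewrite /bessel_coef !expr0 factS !add0n !mul1n natrM.
move: (nz nu) (fz nu); move: (nu.+1%:R) (nu`!%:R) => p q p0 q0.
by field; rewrite p0 q0.
Qed.

Lemma bessel_series0 (R : realType) nu : bessel_series nu (0 : R) = nu`!%:R^-1.
Proof.
rewrite /bessel_series; apply: cvg_lim => //.
rewrite -(cvg_shiftS (pseries (bessel_coef R nu) 0)) /=.
apply: cvg_near_cst; apply: nearW => n.
rewrite /pseries /series /= big_nat_recl//= big1 ?addr0.
  by rewrite expr0 mulr1 /bessel_coef expr0 mul1n mul1r.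
by move=> i _; rewrite expr0n mulr0.
Qed.

Lemma continuous_bessel_series (R : realType) nu : continuous (@bessel_series R nu).
Proof.
move=> t; apply: differentiable_continuous; apply/derivable1_diffP.
exact/ex_derive/is_derive_bessel_series.
Qed.

(** The energy [J_0^2 + J_1^2] does not increase: with [f_0' = - f_1] and
[t f_1' = f_0 - f_1], the derivative of [f_0^2 + t f_1^2] is [- f_1^2]. At 0 the
energy is 1. *)
Lemma bessel_energy (R : realType) (t : R) : 0 <= t ->
  bessel_series 0 t ^+ 2 + t * bessel_series 1 t ^+ 2 <= 1.
Proof.
move=> t_ge0.
pose f (x : R) := - (bessel_series 0 x ^+ 2 + x * bessel_series 1 x ^+ 2).
have fdf (x : R) : is_derive x (1 : R) f (bessel_series 1 x ^+ 2).
  have d0 := is_derive_bessel_series 0 x; have d1 := is_derive_bessel_series 1 x.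
  apply: is_derive_eq; rewrite /GRing.scale /=.
  have := bessel_series_rec 0 x; rewrite mul1r => E.
  transitivity (2 * bessel_series 0 x * bessel_series 1 x
    + 2 * bessel_series 1 x * (x * bessel_series 2 x) - bessel_series 1 x ^+ 2).
    by ring.
  by rewrite E; ring.
have := is_derive_homo fdf (fun x _ => sqr_ge0 _) t_ge0.
by rewrite /f !bessel_series0 !fact0; lra.
Qed.

Lemma besselJE (R : realType) nu (x : R) :
  besselJ nu x = (x / 2) ^+ nu * bessel_series nu ((x / 2) ^+ 2).
Proof.
rewrite /besselJ; apply: cvg_lim => //.
rewrite (_ : series _ =
    fun n => (x / 2) ^+ nu * pseries (bessel_coef R nu) ((x / 2) ^+ 2) n).
  by apply: cvgMr; exact: is_cvg_bessel_series.
apply/funext => n; rewrite /pseries /series /= mulr_sumr; apply: eq_bigr => k _.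
by rewrite exprD exprM /bessel_coef; ring.
Qed.

(** This uniform bound is essential: estimating the power series term by term only
gives exponential growth, which the factor [e^(-2 h lambda)] need not absorb when
the coil distance is large compared with the height. *)
Lemma besselJ_le1 (R : realType) (nu : 'I_2) (x : R) : `|besselJ nu x| <= 1.
Proof.
rewrite -ler_sqr ?nnegrE// expr1n real_normK ?num_real// besselJE.
have := bessel_energy (sqr_ge0 (x / 2)).
move: (x / 2) => y; set t := y ^+ 2 => E.
case: nu => -[|[|//]] _ /=.
  by rewrite expr0 mul1r; apply: le_trans E; rewrite lerDl mulr_ge0 ?sqr_ge0.
by rewrite expr1 exprMn; apply: le_trans E; rewrite lerDr sqr_ge0.
Qed.

Lemma continuous_besselJ (R : realType) nu : continuous (@besselJ R nu).
Proof.
move=> x; rewrite (funext (besselJE nu)).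
have c2 : (y / 2 : R) @[y --> x] --> x / 2 by apply: cvgMl.
have ck k : (y / 2 : R) ^+ k @[y --> x] --> (x / 2) ^+ k.
  exact: continuous_cvg (@exprn_continuous R k _) c2.
apply: cvgM => //; apply: continuous_cvg (ck 2%N).
exact: continuous_bessel_series.
Qed.

(** * Continuity of the forward operator *)

Lemma Rintegral_dominated_cvg d (T : measurableType d) (R : realType)
    (mu : {measure set T -> \bar R}) (D : set T) (f_ : nat -> T -> R)
    (f g : T -> R) : measurable D ->
  (forall k, measurable_fun D (f_ k)) -> measurable_fun D f ->
  (forall x, D x -> f_ k x @[k --> \oo] --> f x) ->
  mu.-integrable D (EFin \o g) ->
  (forall k x, D x -> `|f_ k x| <= g x) ->
  \int[mu]_(x in D) f_ k x @[k --> \oo] --> \int[mu]_(x in D) f x.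
Proof.
move=> mD mf_ mf f_f ig f_g.
have [|||||intf _ Hc] := @dominated_convergence _ _ _ mu D mD
  (fun k => EFin \o f_ k) (EFin \o f) (EFin \o g).
- by move=> k; exact/measurable_EFinP.
- exact/measurable_EFinP.
- by apply: aeW => x Dx; apply: cvg_EFin; [exact: nearW|exact: f_f].
- exact: ig.
- by apply: aeW => x k Dx; rewrite /= lee_fin f_g.
apply: fine_cvg; move: Hc; congr (_ --> _).
by rewrite /Rintegral fineK//; exact: integrable_fin_num.
Qed.

Lemma integrable_exponential_pdf (R : realType) (c r : R) : 0 < r ->
  lebesgue_measure.-integrable `]0, +oo[
    (EFin \o (fun x => c * exponential_pdf r x)).
Proof.
move=> r_gt0; rewrite (_ : _ \o _ = fun x => c%:E * (exponential_pdf r x)%:E)%E//.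
apply: integrableZl => //.
apply: (@integrableS _ _ _ _ setT) => //; apply/integrableP; split.
  by apply/measurable_EFinP; exact: measurable_exponential_pdf.
under eq_integral do rewrite /= ger0_norm ?exponential_pdf_ge0 ?ltW//.
by rewrite integral_exponential_pdf// ltry.
Qed.

(** The integrand is a real weight, independent of the conductivities, times the
reflection factor. Since [J_nu] and the reflection factor are bounded by 1, the
integrand is dominated by [lambda^(2 - nu) e^(-2 h lambda)], hence by a multiple
of the exponential density of rate [h]. *)
Section CoilResponse.
Variables (R : realType) (n : nat) (d : 'I_n -> R) (nu : 'I_2) (h omega rho : R).
Hypotheses (d_gt0 : forall i, 0 < d i) (h_gt0 : 0 < h) (omega_gt0 : 0 < omega).

Let weight (la : R) : R :=
  la ^+ (1 - nu) * expR (- 2 * h * la) * (besselJ nu (rho * la) * la).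

Let weight_cvg (la : R) : weight t @[t --> la] --> weight la.
Proof.
apply: cvgM; apply: cvgM.
- exact: exprn_continuous.
- by apply: continuous_comp; [exact: mulrl_continuous|exact: continuous_expR].
- by apply: continuous_comp; [exact: mulrl_continuous|exact: continuous_besselJ].
- exact: cvg_id.
Qed.

Let dominator (la : R) : R :=
  ((1 - nu).+1`!%:R / h ^+ (1 - nu).+1 / h) * exponential_pdf h la.

Let weight_le (la : R) : 0 < la -> `|weight la| <= dominator la.
Proof.
move=> la_gt0; rewrite /weight /dominator exponential_pdfE ?(ltW la_gt0)//.
have J1 := besselJ_le1 nu (rho * la).
rewrite !normrM (ger0_norm (expR_ge0 _)) normrX !(gtr0_norm la_gt0).
have -> : - 2 * h * la = - h * la + - h * la by ring.
rewrite expRD [leLHS](_ : _ = la ^+ (1 - nu).+1 * expR (- h * la)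
   * (expR (- h * la) * `|besselJ nu (rho * la)|)); last by rewrite exprSr; ring.
have hn0 : h != 0 by rewrite gt_eqF.
rewrite [leRHS](_ : _ =
    (1 - nu).+1`!%:R / h ^+ (1 - nu).+1 * (expR (- h * la) * 1)); last first.
  by rewrite mulr1 -mulrA mulKf.
apply: ler_pM => //; rewrite ?mulr_ge0 ?exprn_ge0 ?expR_ge0 ?(ltW la_gt0)//.
  rewrite mulNr expRN ler_pdivrMr ?expR_gt0//.
  (* A power of [h la] is bounded by a factorial times [expR (h la)]. *)
  have := @expR_ge1Dxn R (h * la) (1 - nu) (mulr_ge0 (ltW h_gt0) (ltW la_gt0)).
  set k := (1 - nu).+1 => H.
  have h1 : (h * la) ^+ k / k`!%:R <= expR (h * la) by lra.
  rewrite mulrAC ler_pdivlMr ?exprn_gt0// -exprMn (mulrC la).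
  by rewrite [leRHS]mulrC -ler_pdivrMr// ltr0n fact_gt0.
by rewrite ler_wpM2l// expR_ge0.
Qed.

Let weighted_integral_cvg (f_ : nat -> R -> R) (f : R -> R) :
  (forall k (la : R), 0 < la -> f_ k t @[t --> la] --> f_ k la) ->
  (forall la : R, 0 < la -> f t @[t --> la] --> f la) ->
  (forall la : R, 0 < la -> f_ k la @[k --> \oo] --> f la) ->
  (forall k (la : R), 0 < la -> `|f_ k la| <= 1) ->
  \int[lebesgue_measure]_(la in `]0, +oo[) (weight la * f_ k la) @[k --> \oo]
  --> \int[lebesgue_measure]_(la in `]0, +oo[) (weight la * f la).
Proof.
move=> cf_ cf f_f f_1.
have pos (la : R) : `]0, +oo[%classic la -> 0 < la by rewrite /= in_itv/= andbT.
have mw (g : R -> R) : (forall la : R, 0 < la -> g t @[t --> la] --> g la) ->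
    measurable_fun (`]0, +oo[ : set R) (fun la : R => weight la * g la).
  move=> cg; apply: open_continuous_measurable_fun => //.
  move=> la; rewrite inE => /pos la_gt0.
  by apply: cvgM; [exact: weight_cvg|exact: cg].
apply: (@Rintegral_dominated_cvg _ _ R lebesgue_measure `]0, +oo[
  (fun k la => weight la * f_ k la) (fun la => weight la * f la) dominator) => //.
- by move=> k; exact: mw (cf_ k).
- exact: mw.
- by move=> la /pos la_gt0; apply: cvgMr; exact: f_f.
- exact: integrable_exponential_pdf.
- move=> k la /pos la_gt0; rewrite normrM -[leRHS]mulr1.
  by apply: ler_pM => //; [exact: weight_le|exact: f_1].
Qed.

Let re_im_reflection_le1 (s : 'I_n.+1 -> R) (la : R) :
    (forall i, 0 <= s i) -> 0 < la ->
  `|complex.Re (reflection d s omega la)| <= 1 /\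
  `|complex.Im (reflection d s omega la)| <= 1.
Proof.
move=> s_ge0 la_gt0; have := reflection_le1 omega_gt0 la_gt0 d_gt0 s_ge0.
have sqr_le1 (x : R) : x ^+ 2 <= 1 -> `|x| <= 1.
  by rewrite -(@ler_sqr _ `|x|) ?nnegrE// real_normK ?num_real// expr1n.
move: (reflection _ _ _ _) => z z_le1.
by split; apply: sqr_le1; apply: le_trans z_le1; rewrite ?lerDl ?lerDr sqr_ge0.
Qed.

Let coil_integralE (s : 'I_n.+1 -> R) : integralC `]0, +oo[ (fun la : R =>
    (la ^+ (1 - nu) * expR (- 2 * h * la))%:C *
    reflection d s omega la * (besselJ nu (rho * la) * la)%:C) =
  (\int[lebesgue_measure]_(la in `]0, +oo[)
    (weight la * complex.Re (reflection d s omega la))) +i*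
  (\int[lebesgue_measure]_(la in `]0, +oo[)
    (weight la * complex.Im (reflection d s omega la))).
Proof.
have weightE (la : R) (z : R[i]) :
    (la ^+ (1 - nu) * expR (- 2 * h * la))%:C * z *
    (besselJ nu (rho * la) * la)%:C =
    (weight la * complex.Re z) +i* (weight la * complex.Im z).
  rewrite /weight; move: (_ * expR _) (_ * la) => x y; case: z => u v.
  by apply/eqP; rewrite eq_complex /=; apply/andP; split; apply/eqP; ring.
by congr (_ +i* _); apply: eq_Rintegral => la _; rewrite weightE.
Qed.

(** Sequential continuity of the forward operator on the non-negative cone. *)
Lemma coil_response_cvg (S : nat -> 'I_n.+1 -> R) (s : 'I_n.+1 -> R) :
  (forall k i, 0 <= S k i) -> (forall i, 0 <= s i) ->
  (forall i, S k i @[k --> \oo] --> s i) ->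
  cvgC \oo (fun k => coil_response d nu (S k) h omega rho)
           (coil_response d nu s h omega rho).
Proof.
move=> S_ge0 s_ge0 cS.
have cl (si : 'I_n.+1 -> R) (la : R) : (forall i, 0 <= si i) -> 0 < la ->
    cvgC (nbhs la) (reflection d si omega) (reflection d si omega la).
  move=> si_ge0 la_gt0.
  by apply: (@cvgC_reflection _ _ _ _ _ _ _ id _ _ (fun=> si)) => // i; exact: cvg_cst.
have cs (la : R) : 0 < la ->
    cvgC \oo (fun k => reflection d (S k) omega la) (reflection d s omega la).
  move=> la_gt0.
  by apply: (@cvgC_reflection _ _ _ _ _ _ _ (fun=> la)) => //; exact: cvg_cst.
apply: cvgC_mul; first exact: cvgC_cst.
rewrite (funext (fun k => coil_integralE (S k))) coil_integralE.
split; apply: weighted_integral_cvg.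
- by move=> k la la_gt0; have [] := cl _ _ (S_ge0 k) la_gt0.
- by move=> la la_gt0; have [] := cl _ _ s_ge0 la_gt0.
- by move=> la la_gt0; have [] := cs _ la_gt0.
- by move=> k la la_gt0; have [] := re_im_reflection_le1 (S_ge0 k) la_gt0.
- by move=> k la la_gt0; have [] := cl _ _ (S_ge0 k) la_gt0.
- by move=> la la_gt0; have [] := cl _ _ s_ge0 la_gt0.
- by move=> la la_gt0; have [] := cs _ la_gt0.
- by move=> k la la_gt0; have [] := re_im_reflection_le1 (S_ge0 k) la_gt0.
Qed.

End CoilResponse.

(** * Existence of a minimizer *)

Lemma cvg_sumr (R : realType) (T : Type) (F : set_system T) (FF : Filter F)
    (I : finType) (f : I -> T -> R) (l : I -> R) :
  (forall i, f i t @[t --> F] --> l i) ->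
  \sum_i f i t @[t --> F] --> \sum_i l i.
Proof.
move=> fl; apply: cvg_big => // -[x y]; apply: cvgD; [exact: cvg_fst|exact: cvg_snd].
Qed.

(** Away from 0 the power is differentiable; at 0, and for any positive exponent,
continuity comes from the monotonicity of the power. *)
Lemma continuous_norm_powR (R : realType) (q : R) : 0 < q ->
  continuous (fun x : R => `|x| `^ q).
Proof.
move=> q_gt0 x; have [->|x0] := eqVneq x 0.
  apply/cvgrPdist_lt => e e_gt0.
  near=> y; rewrite normr0 powR0 ?gt_eqF// sub0r normrN ger0_norm ?powR_ge0//.
  have -> : e = (e `^ q^-1) `^ q by rewrite -powRrM mulVf ?gt_eqF// powRr1// ltW.
  rewrite gt0_ltr_powR ?nnegrE ?powR_ge0//.
  by near: y; apply: cvgr0_norm_lt; [exact: cvg_id|rewrite powR_gt0].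
have nx : 0 < `|x| by rewrite normr_gt0.
apply: (@continuous_comp _ _ _ (fun y : R => `|y|) (fun y => y `^ q)).
  exact: norm_continuous.
apply: differentiable_continuous; apply/derivable1_diffP.
by apply: derivable_powR; rewrite in_itv/= andbT.
Unshelve. all: by end_near. Qed.

(** The extreme value theorem under sequential continuity, the form in which
dominated convergence provides continuity. In a metric space the two notions of
continuity agree. *)
Lemma rV_sequential_min (R : realType) (m : nat) (f : 'rV[R]_m -> R)
    (A : set 'rV[R]_m) :
  A !=set0 -> compact A ->
  (forall (u : nat -> 'rV[R]_m) x, (forall k, A (u k)) -> A x ->
    (forall i, u k ord0 i @[k --> \oo] --> x ord0 i) ->
    f (u k) @[k --> \oo] --> f x) ->
  exists2 x, A x & forall y, A y -> f x <= f y.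
Proof.
move=> A0 cA f_seq; have [|x] := compact_EVT_min A0 cA (f := f); last first.
  rewrite inE => Ax fx; exists x => // y Ay; apply: fx; by rewrite inE.
apply/subspace_continuousP => x Ax; apply/cvgrPdist_lt => e e_gt0.
apply: contrapT => far.
have /choice[u u_far] : forall k : nat, exists y,
    [/\ A y, ball x (k.+1%:R^-1) y & ~ `|f x - f y| < e].
  move=> k; apply: contrapT => near_x; apply: far; apply/nbhs_ballP.
  exists k.+1%:R^-1 => //=.
  move=> y xy Ay; apply: contrapT => fxy; apply: near_x.
  by exists y.
have : f (u k) @[k --> \oo] --> f x.
  apply: f_seq => // [k|i]; first by have [] := u_far k.
  apply/cvgrPdist_lt => r r_gt0; have := near_infty_natSinv_lt (PosNum r_gt0).
  apply: filterS => k; apply: lt_trans.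
  have [_ [_ /(_ ord0 i) xu] _] := u_far k. exact: xu.
move=> /cvgrPdist_lt/(_ _ e_gt0)[k _ /(_ k (leqnn k))] /=.
by have [] := u_far k.
Qed.

Lemma frobenius_sqr (R : realType) (m N : nat) (A : 'M[R[i]]_(m, N)) :
  frobenius A ^+ 2 = \sum_i \sum_j sqmod (A i j).
Proof.
have sq z : ComplexField.Normc.normc z ^+ 2 = sqmod z :> R.
  by case: z => a b; rewrite /sqmod /= sqr_sqrtr// addr_ge0 ?sqr_ge0.
rewrite /frobenius sqr_sqrtr; last by do 2!apply: sumr_ge0 => ? _; exact: sqr_ge0.
by apply: eq_bigr => i _; apply: eq_bigr => j _; exact: sq.
Qed.

Lemma cvg_sqmod (R : realType) (T : Type) (F : set_system T) (FF : Filter F)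
    (f : T -> R[i]) (l : R[i]) : cvgC F f l ->
  sqmod (f t) @[t --> F] --> sqmod l.
Proof.
by move=> [f1 f2]; apply: cvgD; rewrite expr2; under eq_fun do rewrite expr2; exact: cvgM.
Qed.

(** The objective without the indicator function, hence real-valued. *)
Definition finite_objective {R : realType} (n N mrho mh momega : nat) (d : 'I_n -> R)
    (rho : 'I_mrho -> R) (h : 'I_mh -> R) (omega : 'I_momega -> R)
    (ord : 'I_(2 * mrho * mh * momega) -> 'I_2 * 'I_mrho * 'I_mh * 'I_momega)
    (q gamma : R) (B : 'M[R[i]]_(2 * mrho * mh * momega, N))
    (Sigma : 'M[R]_(n.+1, N)) : R :=
  1 / 2 * frobenius (fdem d rho h omega ord Sigma - B) ^+ 2 +
  gamma / q * lq_pow q (discrete_laplacian Sigma).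

Section Existence.
Variables (R : realType) (n N mrho mh momega : nat)
  (d : 'I_n -> R) (rho : 'I_mrho -> R) (h : 'I_mh -> R) (omega : 'I_momega -> R)
  (ord : 'I_(2 * mrho * mh * momega) -> 'I_2 * 'I_mrho * 'I_mh * 'I_momega).
Hypotheses (d_gt0 : forall i, 0 < d i)
  (h_gt0 : forall l, 0 < h l) (omega_gt0 : forall s, 0 < omega s).
Variables (q gamma : R) (B : 'M[R[i]]_(2 * mrho * mh * momega, N)).
Hypotheses (q_gt0 : 0 < q) (gamma_gt0 : 0 < gamma).

Local Notation J := (finite_objective d rho h omega ord q gamma B).

Lemma finite_objective_cvg (S : nat -> 'M[R]_(n.+1, N)) (S0 : 'M[R]_(n.+1, N)) :
  (forall k i j, 0 <= S k i j) -> (forall i j, 0 <= S0 i j) ->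
  (forall i j, S k i j @[k --> \oo] --> S0 i j) ->
  J (S k) @[k --> \oo] --> J S0.
Proof.
move=> S_ge0 S0_ge0 cS; rewrite /finite_objective.
apply: cvgD; apply: cvgMr.
  rewrite frobenius_sqr; under eq_fun do rewrite frobenius_sqr.
  apply: cvg_sumr => k; apply: cvg_sumr => j; apply: cvg_sqmod.
  rewrite !mxE; under eq_fun do rewrite !mxE.
  apply: cvgC_add; last exact: cvgC_cst.
  case: (ord k) => [[[nu t] l] s].
  exact: (coil_response_cvg nu (rho t) d_gt0 (h_gt0 l) (omega_gt0 s)
    (fun k i => S_ge0 k i j) (fun i => S0_ge0 i j) (fun i => cS i j)).
apply: cvg_sumr => k.
have cD : discrete_laplacian (S m) k ord0 @[m --> \oo] --> discrete_laplacian S0 k ord0.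
  rewrite /discrete_laplacian mxE; under eq_fun do rewrite mxE.
  apply: cvg_sumr => l; apply: cvgMr.
  by rewrite mxE; under eq_fun do rewrite mxE; exact: cS.
apply: (@cvg_comp _ _ _ (fun m => discrete_laplacian (S m) k ord0)
  (fun x : R => `|x| `^ q) _ _ _ cD).
exact: continuous_norm_powR.
Qed.

Lemma finite_objective_ge_lq (S : 'M[R]_(n.+1, N)) k :
  gamma / q * `|discrete_laplacian S k ord0| `^ q <= J S.
Proof.
rewrite /finite_objective; apply: ler_wpDl.
  by rewrite mulr_ge0 ?sqr_ge0.
rewrite ler_pM2l ?divr_gt0// /lq_pow (bigD1 k)//= lerDl.
by apply: sumr_ge0 => l _; exact: powR_ge0.
Qed.

(** A bound on the penalty bounds each entry of the Laplacian, and the comparison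
principle transfers the bound to the conductivities. *)
Lemma finite_objective_coercive (c : R) (S : 'M[R]_(n.+1, N)) i j : 0 <= c ->
  J S <= c -> S i j <= (c * q / gamma) `^ q^-1 * parabola R n.+1 i ord0.
Proof.
move=> c_ge0 J_le; apply: laplacian_le_parabola; first exact: powR_ge0.
move=> k; apply: le_trans (ler_norm _) _.
set x := discrete_laplacian S k ord0.
have q_ge0 := ltW q_gt0; have gamma_ge0 := ltW gamma_gt0.
have -> : `|x| = (`|x| `^ q) `^ q^-1.
  by rewrite -powRrM divff ?gt_eqF// powRr1.
apply: ge0_ler_powR; rewrite ?nnegrE ?powR_ge0 ?invr_ge0//.
  by rewrite divr_ge0// mulr_ge0.
rewrite ler_pdivlMr// -ler_pdivrMr// -mulrA mulrC.
by apply: le_trans J_le; exact: finite_objective_ge_lq.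
Qed.

(** Outside the box given by coercivity at level [J 0] the objective exceeds [J 0],
so that a minimizer over the box, which contains 0, is a minimizer over the whole
cone. *)
Lemma finite_objective_min : exists2 S0 : 'M[R]_(n.+1, N),
  (forall i j, 0 <= S0 i j) &
  forall S : 'M[R]_(n.+1, N), (forall i j, 0 <= S i j) -> J S0 <= J S.
Proof.
have J0_ge0 : 0 <= J 0.
  apply: addr_ge0; first by apply: mulr_ge0 => //; exact: sqr_ge0.
  apply: mulr_ge0; first exact/ltW/divr_gt0.
  by apply: sumr_ge0 => l _; exact: powR_ge0.
pose b i := (J 0 * q / gamma) `^ q^-1 * parabola R n.+1 i ord0.
have b_ge0 i : 0 <= b i by rewrite mulr_ge0 ?powR_ge0// ltW// parabola_gt0.
pose c := \sum_i b i.
have c_ge0 : 0 <= c by apply: sumr_ge0.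
pose box : set 'rV[R]_(n.+1 * N) := [set v | forall k, `[0, c] (v ord0 k)].
have boxP v : box v -> forall i j, 0 <= vec_mx v i j.
  move=> boxv i j; rewrite mxE.
  by have := boxv (mxvec_index i j); rewrite /= in_itv => /andP[].
have box0 : box 0 by move=> k; rewrite /= mxE in_itv /= lexx.
(* Flattening to row vectors makes the box compact as a product of segments. *)
have [|||v0 boxv0 minv0] := @rV_sequential_min R (n.+1 * N) (fun v => J (vec_mx v)) box.
- by exists 0.
- by apply: (@rV_compact _ _ (fun=> `[0, c])) => k; exact: segment_compact.
- move=> u x boxu boxx ux; apply: finite_objective_cvg.
  + by move=> k; exact: boxP.
  + exact: boxP.
  + by move=> i j; rewrite mxE; under eq_fun do rewrite mxE; exact: ux.
exists (vec_mx v0); first exact: boxP.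
move=> S S_ge0; have [JS|/ltW JS] := leP (J S) (J 0); last first.
  by apply: le_trans JS; have := minv0 _ box0; rewrite linear0.
rewrite -[S]mxvecK; apply: minv0 => k.
case/mxvec_indexP: k => i j; rewrite mxvecE /= in_itv /= S_ge0 /=.
apply: (le_trans (finite_objective_coercive _ _ J0_ge0 JS)).
by rewrite /c (bigD1 i)//= lerDl; apply: sumr_ge0.
Qed.

Lemma objectiveE (S : 'M[R]_(n.+1, N)) :
  objective d rho h omega ord q gamma B S =
  if [forall i, forall j, 0 <= S i j] then (J S)%:E else +oo%E.
Proof. by rewrite /objective /iota0; case: ifP => _; rewrite ?adde0. Qed.

End Existence.

Theorem proposition3p2 (R : realType) (n N mrho mh momega : nat)
    (d : 'I_n -> R) (rho : 'I_mrho -> R) (h : 'I_mh -> R)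
    (omega : 'I_momega -> R)
    (ord : 'I_(2 * mrho * mh * momega) -> 'I_2 * 'I_mrho * 'I_mh * 'I_momega)
    (d_gt0 : forall i, 0 < d i) (rho_gt0 : forall t, 0 < rho t)
    (h_gt0 : forall l, 0 < h l) (omega_gt0 : forall s, 0 < omega s)
    (ord_bij : bijective ord)
    (q gamma : R) (q_gt0 : 0 < q) (q_le2 : q <= 2) (gamma_gt0 : 0 < gamma)
    (B : 'M[R[i]]_(2 * mrho * mh * momega, N)) :
  exists Smin : 'M[R]_(n.+1, N), forall Sigma : 'M[R]_(n.+1, N),
    (objective d rho h omega ord q gamma B Smin
       <= objective d rho h omega ord q gamma B Sigma)%E.
Proof.
have [Smin Smin_ge0 minS] :=
  finite_objective_min rho ord d_gt0 h_gt0 omega_gt0 B q_gt0 gamma_gt0.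
exists Smin => Sigma; rewrite !objectiveE; case: ifP => [_|]; last first.
  by move/negbT/negP; case; apply/forallP => i; apply/forallP => j.
case: ifPn => [/forallP S_ge0|_]; last exact: leey.
by rewrite lee_fin; apply: minS => i j; have /forallP := S_ge0 i.
Qed.
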